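(* Consider a polynomial system $\mathcal{P}=\{p_1=0,\dots,p_m=0\}$ in $x_1,\dots,x_n$ with finite variety $S=V(\mathcal{P})$ such that $\|S\|\le 2^{\mathrm{poly}(n^d)}$. Assume that (1) $S$ is $\delta$-spectrally rich up to degree $d$, and (2) $\mathcal{P}$ is $\text{SoS}_\varepsilon$-complete over $S$. Let $r$ be a polynomial. If ''$r\ge0$'' has a degree-$2d$ SoS proof $r=\sum_{i=1}^{t_0}\sigma_i^2+\sum_{i=1}^mh_ip_i$, then for every $\varepsilon>0$ there exists an SoS proof of ''$r+\varepsilon\ge0$'' of degree $O(d)$, $$r+\varepsilon=\sum_{i=1}^t\tilde\sigma_i^2+\sum_{i=1}^m\tilde h_ip_i,$$ such that the coefficients of every polynomial appearing in the proof are bounded in absolute value by $2^{\mathrm{poly}(n^d,\lg\frac1\delta,\lg\frac1\varepsilon)}$.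
   Context: Standing assumptions: $d$ is fixed and bounds are as $n\to\infty$; the bit complexity of $\mathcal{P}$ and of $r$ is polynomial in $n$ (so coefficients of $r$ are bounded by $2^{\mathrm{poly}(n^d)}$); $\|S\|=\max_{\alpha\in S}\|\alpha\|$. SoS proof of ''$q\ge0$'' from $\mathcal{P}$: identity $q=\sum s_i^2+\sum h_ip_i$, degree $=\max(\deg s_i^2,\deg h_ip_i)$. Let $\mathbf v_d$ be the vector of all monomials of degree $\le d$ and $M=\frac1{|S|}\sum_{\alpha\in S}\mathbf v_d(\alpha)\mathbf v_d(\alpha)^{\mathsf T}$ the moment matrix; $S$ is $\delta$-spectrally rich up to degree $d$ if every nonzero eigenvalue of $M$ is at least $\delta$. $I_{2d}(S)$ denotes the polynomials of degree $\le 2d$ vanishing on $S$, and $\|q\|_\infty$ the maximal absolute value of a coefficient of $q$. $\mathcal{P}$ is $\text{SoS}_\varepsilon$-complete over $S$ if for every $q\in I_{2d}(S)$ and every $\varepsilon>0$ there is an SoS proof of ''$q+\varepsilon\ge0$'' from $\mathcal{P}$ of degree $O(d)$ with coefficients bounded in absolute value by $2^{\mathrm{poly}(n^d,\lg\|q\|_\infty,\lg\frac1\varepsilon)}$. *)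

(* Defs.v *)
From HB Require Import structures.
From mathcomp Require Import all_boot all_order all_algebra finmap mpoly.
From mathcomp Require Import reals exp.
Set Implicit Arguments.
Unset Strict Implicit.
Unset Printing Implicit Defensive.
Import Order.TTheory GRing.Theory Num.Theory.
Local Open Scope ring_scope.

(** Asymptotic conventions: "poly(a, b, c)" is the value at (a, b, c) of a real
    polynomial that is fixed before the instance (n and the polynomial system),
    and "O(d)" is [C * d] for a constant [C] fixed before [d].  *)

(** Binary logarithm truncated below at 0, the usual convention for arguments of
    "poly": [lg x = 0] for [x <= 1], in particular [lg 0 = 0]. *)
Definition lg (R : realType) (x : R) : R := Num.max 0 (ln x / ln 2).

Definition poly3 (R : realType) (f : {mpoly R[3]}) (a b c : R) : R :=
  f.@[tnth [tuple a; b; c]].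

(** Degree, with the degree of the zero polynomial being 0. *)
Definition mpdeg (R : realType) (n : nat) (p : {mpoly R[n]}) : nat :=
  (msize p).-1.

Definition coef_norm (R : realType) (n : nat) (q : {mpoly R[n]}) : R :=
  \big[Num.max/0]_(mo <- msupp q) `|q@_mo|.

Definition evalpt (R : realType) (n : nat) (q : {mpoly R[n]}) (a : 'rV[R]_n) : R :=
  q.@[fun i => a 0 i].

Section BitComplexity.

Definition nat_bits (k : nat) : nat := (trunc_log 2 k).+1.

(** The additional bit is the sign. *)
Definition int_bits (z : int) : nat := (nat_bits `|z|%N).+1.

Definition rat_bits (c : rat) : nat := (int_bits (numq c) + int_bits (denq c))%N.

Definition mnm_bits (n : nat) (mo : 'X_{1..n}) : nat :=
  (\sum_(i < n) nat_bits (mo i))%N.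

(** Size of the list of (coefficient, exponent vector) pairs of [p]. *)
Definition mpoly_bits (n : nat) (p : {mpoly rat[n]}) : nat :=
  (\sum_(mo <- msupp p) (rat_bits p@_mo + mnm_bits mo)).+1%N.

(** The family [p] consists of polynomials with rational coefficients, whose
    total encoding length is at most [b]. *)
Definition bit_complexity_le (R : realType) (n m : nat)
    (p : 'I_m -> {mpoly R[n]}) (b : R) : Prop :=
  exists p0 : 'I_m -> {mpoly rat[n]},
    (forall i, p i = map_mpoly (ratr : rat -> R) (p0 i)) /\
    (\sum_(i < m) mpoly_bits (p0 i))%N%:R <= b.

End BitComplexity.

(** [S] is the (real) variety of [P]; [S] being an [fset], it is finite. *)
Definition is_variety (R : realType) (n m : nat) (P : 'I_m -> {mpoly R[n]})
    (S : {fset 'rV[R]_n}) : Prop :=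
  forall a : 'rV[R]_n, a \in S <-> (forall i, evalpt (P i) a = 0).

(** Not [`|a|], which is the max norm on matrices. *)
Definition euclid_norm (R : realType) (n : nat) (a : 'rV[R]_n) : R :=
  Num.sqrt (\sum_(i < n) a 0 i ^+ 2).

Definition set_norm (R : realType) (n : nat) (S : {fset 'rV[R]_n}) : R :=
  \big[Num.max/0]_(a <- S) euclid_norm a.

(** Values at [a] of the monomials of degree at most [d], enumerated in the order
    of the finite type ['X_{1..n < d.+1}]. *)
Definition mon_vec (R : realType) (n d : nat) (a : 'rV[R]_n) :
    'cV[R]_#|{: 'X_{1..n < d.+1}}| :=
  \col_i evalpt 'X_[bmnm (enum_val i)] a.

Definition moment_mx (R : realType) (n d : nat) (S : {fset 'rV[R]_n}) :
    'M[R]_#|{: 'X_{1..n < d.+1}}| :=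
  (#|` S|%fset%:R)^-1 *: \sum_(a <- S) (mon_vec d a *m (mon_vec d a)^T).

Definition spectrally_rich (R : realType) (n d : nat) (delta : R)
    (S : {fset 'rV[R]_n}) : Prop :=
  forall l : R, eigenvalue (moment_mx d S) l -> l != 0 -> delta <= l.

(** [vanishing k S q] is membership of [q] in the space I_k(S). *)
Definition vanishing (R : realType) (n k : nat) (S : {fset 'rV[R]_n})
    (q : {mpoly R[n]}) : Prop :=
  (mpdeg q <= k)%N /\ (forall a, a \in S -> evalpt q a = 0).

(** SoS proofs of "q >= 0" from the equations P = 0. *)
Record sos_proof (R : realType) (n m : nat) (P : 'I_m -> {mpoly R[n]})
    (q : {mpoly R[n]}) := SosProof {
  sos_sq : seq {mpoly R[n]};
  sos_mult : 'I_m -> {mpoly R[n]};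
  sos_eq : q = \sum_(s <- sos_sq) s ^+ 2 + \sum_(i < m) sos_mult i * P i
}.

Definition sos_degree (R : realType) (n m : nat) (P : 'I_m -> {mpoly R[n]})
    (q : {mpoly R[n]}) (pf : sos_proof P q) : nat :=
  maxn (\max_(s <- sos_sq pf) mpdeg (s ^+ 2))
       (\max_(i < m) mpdeg (sos_mult pf i * P i)).

Definition sos_coef_le (R : realType) (n m : nat) (P : 'I_m -> {mpoly R[n]})
    (q : {mpoly R[n]}) (pf : sos_proof P q) (B : R) : Prop :=
  (forall s, s \in sos_sq pf -> coef_norm s <= B) /\
  (forall i, coef_norm (sos_mult pf i) <= B).

(** [C] and [f] are the constant of "O(d)" and the polynomial in the exponent of
    the coefficient bound. *)
Definition sos_eps_complete (R : realType) (n m d C : nat) (f : {mpoly R[3]})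
    (P : 'I_m -> {mpoly R[n]}) (S : {fset 'rV[R]_n}) : Prop :=
  forall q : {mpoly R[n]}, vanishing (2 * d)%N S q ->
  forall eps : R, 0 < eps ->
  exists pf : sos_proof P (q + eps%:MP),
    (sos_degree pf <= C * d)%N /\
    sos_coef_le pf (2 `^ poly3 f (n ^ d)%N%:R (lg (coef_norm q)) (lg eps^-1)).

(* Main.v *)
Require Import Defs.
From HB Require Import structures.
From mathcomp Require Import all_boot all_order all_algebra finmap mpoly.
From mathcomp Require Import reals exp.
From mathcomp Require Import ssrcomplements complex spectral zify lra.
Set Implicit Arguments.
Unset Strict Implicit.
Unset Printing Implicit Defensive.
Import Order.TTheory GRing.Theory Num.Theory.
Local Open Scope ring_scope.

(** Replace the coefficient vector of each square [sigma_i] by its orthogonal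
    projection onto the row space of the moment matrix [M] of [S].  The kernel of
    [M] consists of the polynomials vanishing on [S], so the values on [S] do not
    change, whereas spectral richness gives
      delta * sum_i |sigma_i'|^2 <= average over S of sum_i sigma_i^2
                                  = average over S of r,
    and the right-hand side is bounded because [S] and the coefficients of [r] are.
    Hence [r - sum_i sigma_i'^2] lies in I_2d(S) with controlled coefficients, and
    SoS_eps-completeness applies to it. *)

(** * Linear algebra of real symmetric matrices *)

Lemma sum_sqr_eq0 (R : realDomainType) N (x : 'rV[R]_N) :
  (x *m x^T) 0 0 = 0 -> x = 0.
Proof.
rewrite mxE => /eqP; under eq_bigr do rewrite mxE -expr2.
rewrite psumr_eq0 => [/allP x0|i _]; last exact: sqr_ge0.
apply/rowP => i; rewrite mxE; apply/eqP.
by rewrite -sqrf_eq0 (implyP (x0 i _)) // mem_index_enum.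
Qed.

(* The row space of a real symmetric matrix meets its kernel trivially, so it is
   a complement of the kernel. *)
Lemma sym_rowspace_kernel (R : realFieldType) N (M : 'M[R]_N) (c : 'rV[R]_N) :
  M^T = M -> exists y : 'rV[R]_N, (c - y *m M) *m M = 0.
Proof.
(* If k M^2 = 0, the squared norm k M M k^T of k M vanishes. So M^2 and M have the same kernel,
   hence the same rank and row space, and c M = y M^2 is solvable. *)
move=> symM; have ker_sq : (kermx (M *m M) <= kermx M)%MS.
  apply/rV_subP => k /sub_kermxP kMM; apply/sub_kermxP.
  by apply: sum_sqr_eq0; rewrite trmx_mul symM !mulmxA -(mulmxA k) kMM mul0mx mxE.
have rk : (\rank M <= \rank (M *m M))%N.
  have := mxrankS ker_sq; rewrite !mxrank_ker leq_sub2lE //.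
  exact: rank_leq_row.
have : (c *m M <= M *m M)%MS.
  apply: submx_trans (submxMl c M) _.
  by rewrite -(geq_leqif (mxrank_leqif_sup (submxMl M M))).
by case/submxP => y Ey; exists y; rewrite mulmxBl Ey mulmxA subrr.
Qed.

Section SpectralGap.
Local Open Scope sesquilinear_scope.

(** Diagonalise M unitarily over the complex numbers. In the eigenbasis the coordinates of y M are
    those of y times the eigenvalues, so they vanish on the kernel directions; on all the others the
    eigenvalue is at least delta. *)
Lemma sym_spectral_gap (R : rcfType) N (M : 'M[R]_N) (delta : R) (y : 'rV[R]_N) :
  M^T = M ->
  (forall l, eigenvalue M l -> l != 0 -> delta <= l) ->
  delta * ((y *m M) *m (y *m M)^T) 0 0 <= ((y *m M) *m M *m (y *m M)^T) 0 0.
Proof.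
move=> symM gap; move Ex: (y *m M) => x.
pose toC := real_complex R; pose MC := map_mx toC M.
have conj_toC m n (A : 'M[R]_(m, n)) : (map_mx toC A) ^t* = map_mx toC A^T.
  apply/matrixP => i j; rewrite !mxE; apply/CrealP.
  by rewrite complex_real.
have hermM : MC \is hermsymmx.
  by apply/is_hermitianmxP; rewrite expr0 scale1r conj_toC symM.
have /hermitian_normalmx/orthomx_spectralP := hermM.
have /mxOverP := hermitian_spectral_diag_real hermM.
have := spectral_unitarymx MC; have := spectral_unit MC.
move: (spectralmx MC) (spectral_diag MC) => U D Uunit Uunitary Dreal defM.
have UUt : U ^t* *m U = 1%:M by rewrite -invmx_unitary // mulVmx.
pose w := map_mx toC x *m U ^t*.
have wE i : w 0 i = (map_mx toC y *m U ^t*) 0 i * D 0 i.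
  rewrite /w -Ex map_mxM -/MC defM invmx_unitary //.
  rewrite -!mulmxA (unitarymxP Uunitary) mulmx1 !mulmxA.
  by rewrite mul_mx_diag mxE.
(* The gap is assumed for real eigenvalues only. A diagonal entry is real and is a root of the
   characteristic polynomial of the complexified M, so it is an eigenvalue of M itself; row i of U
   is the eigenvector. *)
have Dgap i : D 0 i != 0 -> toC delta <= D 0 i.
  move=> Dn0; have /complex_realP[l El] := Dreal 0 i.
  rewrite El lecR; apply: gap; last first.
    by apply: contra_neq Dn0 => l0; rewrite El l0.
  rewrite eigenvalue_root_char -(fmorph_root toC) map_char_poly -/MC.
  rewrite -[X in root _ X]/(l%:C%C) -El.
  rewrite -eigenvalue_root_char; apply/eigenvalueP; exists (row i U).
    rewrite -row_mul defM mulmxA mulmxA mulmxV // mul1mx.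
    by rewrite row_mul row_diag_mx -scalemxAl -rowE.
  (* A zero row in U would give a zero row in U U^-1 = 1. *)
  apply/eqP => U0; have := mulmxV Uunit; move/(congr1 (row i)).
  rewrite row_mul U0 mul0mx => /rowP/(_ i) /eqP.
  by rewrite !mxE eqxx eq_sym oner_eq0.
(* Change of basis for quadratic forms, used with A the diagonal matrix of eigenvalues and with A =
   1. *)
have qf (A : 'M[R[i]]_N) : ((map_mx toC x *m (U ^t* *m A *m U) *m map_mx toC x^T) 0 0
    = (w *m A *m w ^t*) 0 0)%R.
  by rewrite /w trmx_mul map_mxM trmxCK conj_toC !mulmxA.
clearbody w; rewrite -lecR.
have -> : ((x *m M *m x^T) 0 0)%:C%C = (map_mx toC x *m MC *m map_mx toC x^T) 0 0.
  by rewrite -!map_mxM [RHS]mxE.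
rewrite defM invmx_unitary // qf.
have -> : (delta * (x *m x^T) 0 0)%:C%C = toC delta * (w *m 1%:M *m w ^t*) 0 0.
  by rewrite -qf mulmx1 UUt mulmx1 -map_mxM [in RHS]mxE rmorphM.
rewrite mulmx1 mul_mx_diag !mxE mulr_sumr; apply: ler_sum => i _.
rewrite !mxE mulrAC -normCK mulrC.
have [D0|Dn0] := eqVneq (D 0 i) 0; first by rewrite wE D0 mulr0 normr0 expr0n mul0r mulr0.
by rewrite ler_wpM2l ?exprn_ge0 // Dgap.
Qed.

End SpectralGap.

(** * Coefficient vectors, the moment matrix and reduced squares *)

Definition coef_sqnorm (R : realType) (n : nat) (q : {mpoly R[n]}) : R :=
  \sum_(mo <- msupp q) q@_mo ^+ 2.

Lemma coef_sqnorm_wE (R : realType) n k (q : {mpoly R[n]}) : (msize q <= k)%N ->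
  coef_sqnorm q = \sum_(mo : 'X_{1..n < k}) q@_mo ^+ 2.
Proof.
move=> lt_qk; pose I : subFinType _ := 'X_{1..n < k}.
rewrite /coef_sqnorm (big_mksub I) //=; first last.
  by move=> x /msize_mdeg_lt /leq_trans; apply.
  by rewrite msupp_uniq.
by rewrite big_rmcond //= => i; move/memN_msupp_eq0 ->; rewrite expr0n.
Qed.

Lemma coef_sqnorm_ge0 (R : realType) n (q : {mpoly R[n]}) : 0 <= coef_sqnorm q.
Proof. by apply: sumr_ge0 => ? _; apply: sqr_ge0. Qed.

Lemma sqr_mcoeff_le (R : realType) n (q : {mpoly R[n]}) mo :
  q@_mo ^+ 2 <= coef_sqnorm q.
Proof.
have [mq|/memN_msupp_eq0 ->] := boolP (mo \in msupp q); last first.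
  by rewrite expr0n coef_sqnorm_ge0.
rewrite /coef_sqnorm (bigD1_seq mo) //= ?lerDl ?sumr_ge0 // => ? _.
exact: sqr_ge0.
Qed.

Lemma mpdeg_leq (R : realType) n (q : {mpoly R[n]}) k :
  (mpdeg q <= k)%N = (msize q <= k.+1)%N.
Proof. by rewrite /mpdeg; case: (msize q). Qed.

Section Monomials.
Variables (R : realType) (n d : nat).
Local Notation N := #|{: 'X_{1..n < d.+1}}|.
Implicit Types (c : 'rV[R]_N) (S : {fset 'rV[R]_n}).

Definition vec_mpoly c : {mpoly R[n]} :=
  \sum_i c 0 i *: 'X_[bmnm (enum_val i)].

Lemma mpdeg_vec_mpoly c : (mpdeg (vec_mpoly c) <= d)%N.
Proof.
rewrite mpdeg_leq; apply: leq_trans (msize_sum _ _ _) _.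
apply/bigmax_leqP => i _; apply: leq_trans (msizeZ_le _ _) _.
by rewrite msizeX; case: (enum_val i).
Qed.

Lemma mcoeff_vec_mpoly c i : (vec_mpoly c)@_(bmnm (enum_val i)) = c 0 i.
Proof.
rewrite raddf_sum (bigD1 i) //= mcoeffZ mcoeffX eqxx mulr1 big1 ?addr0 // => j ji.
rewrite mcoeffZ mcoeffX -bmeqP (inj_eq enum_val_inj) (negPf ji).
by rewrite mulr0.
Qed.

Lemma coef_sqnorm_vec_mpoly c : coef_sqnorm (vec_mpoly c) = (c *m c^T) 0 0.
Proof.
have := mpdeg_vec_mpoly c; rewrite mpdeg_leq => /coef_sqnorm_wE ->.
rewrite big_enum_val mxE; apply: eq_bigr => i _.
by rewrite mcoeff_vec_mpoly mxE expr2.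
Qed.

Lemma vec_mpolyK (p : {mpoly R[n]}) : (mpdeg p <= d)%N ->
  vec_mpoly (\row_i p@_(bmnm (enum_val i))) = p.
Proof.
rewrite mpdeg_leq => /mpolywE {2}->; rewrite big_enum_val.
by apply: eq_bigr => i _; rewrite mxE.
Qed.

Lemma evalpt_vec_mpoly c a : evalpt (vec_mpoly c) a = (c *m mon_vec d a) 0 0.
Proof.
rewrite /evalpt raddf_sum mxE; apply: eq_bigr => i _.
by rewrite /= mevalZ mxE.
Qed.

Lemma moment_mx_sym S : (moment_mx d S)^T = moment_mx d S.
Proof.
rewrite /moment_mx linearZ /= linear_sum; congr (_ *: _).
by apply: eq_bigr => a _; rewrite /= trmx_mul trmxK.
Qed.

Lemma moment_mx_form c S :
  (c *m moment_mx d S *m c^T) 0 0 =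
  (#|` S|%fset%:R)^-1 * \sum_(a <- S) evalpt (vec_mpoly c) a ^+ 2.
Proof.
rewrite /moment_mx -scalemxAr -scalemxAl mxE mulmx_sumr mulmx_suml summxE.
congr (_ * _); apply: eq_bigr => a _.
rewrite evalpt_vec_mpoly mulmxA -(mulmxA (c *m _)) -trmx_mul mxE big_ord1.
by rewrite [X in _ * X]mxE expr2.
Qed.

(** The quadratic form of the moment matrix at c is an average of squares of values on S, so it
    vanishes only if every value does. *)
Lemma moment_mx_ker c S a : c *m moment_mx d S = 0 -> a \in S ->
  evalpt (vec_mpoly c) a = 0.
Proof.
move=> cM0 aS; have := moment_mx_form c S; rewrite cM0 mul0mx mxE => /esym/eqP.
rewrite mulf_eq0 invr_eq0 pnatr_eq0 cardfs_eq0 psumr_eq0 => [|? _]; last exact: sqr_ge0.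
case/orP => [/eqP S0|/allP/(_ a aS)]; first by rewrite S0 inE in aS.
by rewrite /= sqrf_eq0 => /eqP.
Qed.

(** The coefficient vector of s is split into a row-space part and a kernel part of M. The kernel
    part vanishes on S; on the row-space part the spectral gap bounds the norm by the quadratic
    form, which sees only values on S. *)
Lemma spectrally_rich_representative S (delta : R) (s : {mpoly R[n]}) :
  spectrally_rich d delta S -> (mpdeg s <= d)%N ->
  exists s' : {mpoly R[n]},
    [/\ (mpdeg s' <= d)%N, {in S, forall a, evalpt s' a = evalpt s a}
      & delta * coef_sqnorm s' <=
        (#|` S|%fset%:R)^-1 * \sum_(a <- S) evalpt s a ^+ 2].
Proof.
move=> rich /vec_mpolyK; set c := \row_i _ => <-.
have [y kery] := sym_rowspace_kernel c (moment_mx_sym S).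
have agree : {in S, forall a,
    evalpt (vec_mpoly (y *m moment_mx d S)) a = evalpt (vec_mpoly c) a}.
  move=> a aS; have := moment_mx_ker kery aS.
  by rewrite !evalpt_vec_mpoly mulmxBl !mxE => /eqP; rewrite subr_eq0 => /eqP ->.
exists (vec_mpoly (y *m moment_mx d S)); split => //.
  exact: mpdeg_vec_mpoly.
rewrite coef_sqnorm_vec_mpoly.
apply: le_trans (sym_spectral_gap y (moment_mx_sym S) rich) _.
rewrite moment_mx_form le_eqVlt; apply/orP; left; apply/eqP; congr (_ * _).
by apply: eq_big_seq => a aS; rewrite agree.
Qed.

End Monomials.

(** The coefficient is the sum of the products of coefficients at m1 and m2 with m1 + m2 = mo. Each
    product is at most half the sum of the two squares, and each m1 has at most one partner m2, so
    no factor counting monomials appears. *)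
Lemma mcoeff_sqr_le (R : realType) n (s : {mpoly R[n]}) mo :
  `|(s ^+ 2)@_mo| <= coef_sqnorm s.
Proof.
pose k m1 m2 : R := (m1 + m2 == mo)%MM%:R.
have k_sym m1 m2 : k m1 m2 = k m2 m1 by rewrite /k addmC.
have k_le m1 : \sum_(m2 <- msupp s) k m1 m2 <= 1.
  have [/hasP[m2 m2s /eqP E]|none] := boolP (has (fun m2 => m1 + m2 == mo)%MM (msupp s)).
    rewrite (bigD1_seq m2) //= big1 ?addr0; first by rewrite /k lern1 leq_b1.
    by move=> m3 ne; rewrite /k -E (inj_eq (@addmI _ m1)) (negPf ne).
  by rewrite big1_seq ?ler01 // => m2 /andP[_ m2s]; rewrite /k (negPf (hasPn none _ m2s)).
have sq_le : \sum_(m1 <- msupp s) \sum_(m2 <- msupp s) s@_m1 ^+ 2 * k m1 m2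
    <= coef_sqnorm s.
  apply: ler_sum => m1 _; rewrite -mulr_sumr.
  by rewrite -[leRHS]mulr1 ler_wpM2l ?sqr_ge0.
rewrite expr2 mpolyME raddf_sum big_allpairs /=.
apply: le_trans (ler_norm_sum _ _ _) _.
apply: (@le_trans _ _ (\sum_(m1 <- msupp s) \sum_(m2 <- msupp s)
    (s@_m1 ^+ 2 * k m1 m2 + s@_m2 ^+ 2 * k m2 m1) / 2)); last first.
  under eq_bigr do rewrite -mulr_suml big_split /=.
  rewrite -mulr_suml big_split /= [X in _ + X]exchange_big /=.
  by rewrite ler_pdivrMr // mulr_natr mulr2n lerD.
apply: ler_sum => m1 _; apply: le_trans (ler_norm_sum _ _ _) _.
apply: ler_sum => m2 _; rewrite mcoeffZ mcoeffX -/(k m1 m2) (k_sym m2) -mulrDl.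
have : 0 <= k m1 m2 by rewrite ler0n.
move: (k m1 m2) (s@_m1) (s@_m2) => K a b K0.
rewrite normrM (ger0_norm K0) mulrAC ler_wpM2r // ler_pdivlMr //.
have := sqr_ge0 (a + b); have := sqr_ge0 (a - b); rewrite !expr2.
by case: (ler0P (a * b)) => _; lra.
Qed.

(** The number of squares in the given proof is not bounded. Bounding the total squared norm at once
    keeps that number out of the estimate. *)
Lemma spectrally_rich_representatives (R : realType) n d (S : {fset 'rV[R]_n})
    (delta : R) (l : seq {mpoly R[n]}) :
  spectrally_rich d delta S -> {in l, forall s, (mpdeg s <= d)%N} ->
  exists l' : seq {mpoly R[n]},
    [/\ {in l', forall s, (mpdeg s <= d)%N},
      {in S, forall a, \sum_(s <- l') evalpt s a ^+ 2 = \sum_(s <- l) evalpt s a ^+ 2}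
      & delta * (\sum_(s <- l') coef_sqnorm s) <=
        (#|` S|%fset%:R)^-1 * \sum_(a <- S) \sum_(s <- l) evalpt s a ^+ 2].
Proof.
move=> rich; elim: l => [_|s l IHl ldeg].
  exists [::]; split => //; rewrite big_nil mulr0 big1 ?mulr0 // => a _.
  by rewrite big_nil.
have [|l' [l'deg l'S l'le]] := IHl; first by move=> t tl; rewrite ldeg // inE tl orbT.
have [s' [s'deg s'S s'le]] := spectrally_rich_representative rich (ldeg s (mem_head _ _)).
exists (s' :: l'); split.
- by move=> t; rewrite inE => /orP[/eqP ->|/l'deg].
- by move=> a aS; rewrite !big_cons s'S // l'S.
under [X in _ <= _ * X]eq_bigr do rewrite big_cons.
by rewrite big_cons big_split /= !mulrDr lerD.
Qed.

(** * Values of a polynomial on S, from its bit length and the norm of S *)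

Definition coef_l1norm (R : realType) (n : nat) (q : {mpoly R[n]}) : R :=
  \sum_(mo <- msupp q) `|q@_mo|.

Lemma normr_mcoeff_le (R : realType) n (q : {mpoly R[n]}) mo :
  `|q@_mo| <= coef_l1norm q.
Proof.
have [mq|/memN_msupp_eq0 ->] := boolP (mo \in msupp q); last first.
  by rewrite normr0 sumr_ge0.
by rewrite /coef_l1norm (bigD1_seq mo) //= lerDl sumr_ge0.
Qed.

Lemma normr_evalpt_le (R : realType) n k (q : {mpoly R[n]}) (a : 'rV[R]_n) (B : R) :
  (mpdeg q <= k)%N -> 1 <= B -> (forall i, `|a 0 i| <= B) ->
  `|evalpt q a| <= coef_l1norm q * B ^+ k.
Proof.
rewrite mpdeg_leq => qk B1 aB; rewrite /evalpt mevalE.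
apply: le_trans (ler_norm_sum _ _ _) _.
rewrite mulr_suml big_seq [leRHS]big_seq; apply: ler_sum => mo /msize_mdeg_lt moq.
rewrite normrM ler_wpM2l // normr_prod.
apply: (@le_trans _ _ (B ^+ mdeg mo)).
  rewrite mdegE expr_sum; apply: ler_prod => i _.
  by rewrite normr_ge0 normrX lerXn2r // nnegrE (le_trans ler01).
by rewrite ler_weXn2l // -ltnS (leq_trans moq).
Qed.

Lemma coef_norm_le (R : realType) n (q : {mpoly R[n]}) (B : R) :
  0 <= B -> (forall mo, `|q@_mo| <= B) -> coef_norm q <= B.
Proof. by move=> B0 qB; apply: bigmax_le. Qed.

Lemma normr_coord_le (R : realType) n (S : {fset 'rV[R]_n}) a i :
  a \in S -> `|a 0 i| <= set_norm S.
Proof.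
move=> aS; apply: (@le_trans _ _ (euclid_norm a)); last first.
  exact: le_bigmax_seq.
rewrite /euclid_norm -sqrtr_sqr ler_wsqrtr // (bigD1 i) //= lerDl sumr_ge0 // => ? _.
exact: sqr_ge0.
Qed.

(** The denominator only decreases the absolute value. The exponent can be lowered by one thanks to
    the sign bit, which pays for the successor in [sum_exp2_le]. *)
Lemma normr_rat_le (c : rat) : `|c| <= (2 ^ (rat_bits c).-1)%N%:R.
Proof.
have num_lt : (`|numq c| < 2 ^ nat_bits `|numq c|)%N by apply: trunc_log_ltn.
apply: (@le_trans _ _ (`|numq c|%N%:R)).
  rewrite natr_absz intr_norm numqE normrM ler_peMr //.
  by rewrite ger0_norm ?ler0z ?ler1z ?denq_ge0 // -gtz0_ge1 denq_gt0.
rewrite ler_nat (leq_trans (ltnW num_lt)) // leq_exp2l //.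
by rewrite /rat_bits /int_bits addSn leq_addr.
Qed.

(** If Y >= 1 is the power bounding the tail, then 2^(a+1) Y = 2^a Y + 2^a Y >= 2^a + Y; hence the
    successor on each exponent. *)
Lemma sum_exp2_le (I : eqType) (s : seq I) (F : I -> nat) :
  (\sum_(i <- s) 2 ^ F i <= 2 ^ (\sum_(i <- s) (F i).+1))%N.
Proof.
elim: s => [|i s IHs]; first by rewrite !big_nil.
rewrite !big_cons addSn expnS expnD mul2n -addnn leq_add //.
  by rewrite leq_pmulr // expn_gt0.
by rewrite (leq_trans IHs) // leq_pmull // expn_gt0.
Qed.

(** Every monomial of the support is paid for in the encoding, so the bit length controls even the
    sum of the coefficients, and values on S can be bounded without counting monomials. *)
Lemma coef_l1norm_bits (R : realType) n (q : {mpoly R[n]}) (b : R) :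
  bit_complexity_le (fun _ : 'I_1 => q) b -> coef_l1norm q <= 2 `^ b.
Proof.
case=> q0 [/(_ ord0) -> ]; rewrite big_ord1; set p := q0 ord0 => pb.
apply: (@le_trans _ _ (2 `^ (mpoly_bits p)%:R)); last first.
  by rewrite ler_powR // ler1n.
rewrite powR_mulrn // -natrX /coef_l1norm.
rewrite (perm_big _ (msupp_map_mpoly _ (fmorph_inj _))) /=.
apply: (@le_trans _ _ ((\sum_(mo <- msupp p) 2 ^ (rat_bits p@_mo).-1)%N%:R)).
  rewrite natr_sum; apply: ler_sum => mo _.
  by rewrite mcoeff_map_mpoly -ratr_norm -[leRHS](ratr_nat R) ler_rat normr_rat_le.
rewrite ler_nat (leq_trans (sum_exp2_le _ _)) // leq_exp2l //.
by rewrite leqW // leq_sum // => mo _; rewrite leq_addr.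
Qed.

(** * Truncated logarithms, powers of 2 and monotone majorants of polynomials *)

Lemma lg_ge0 (R : realType) (x : R) : 0 <= lg x.
Proof. by rewrite /lg le_max lexx. Qed.

Lemma le_powR_lg (R : realType) (x : R) : x <= 2 `^ lg x.
Proof.
have [x0|x0] := leP x 0; first exact: le_trans x0 (powR_ge0 _ _).
rewrite -ler_ln ?posrE ?powR_gt0 // ln_powR -ler_pdivrMr ?ln_gt0 ?ltr1n //.
by rewrite /lg le_max lexx orbT.
Qed.

Lemma lg_le (R : realType) (x y : R) : 0 <= y -> x <= 2 `^ y -> lg x <= y.
Proof.
move=> y0 xy; rewrite /lg ge_max y0 /=.
(* For x <= 0 the logarithm takes its default value 0. *)
have [x0|x0] := leP x 0; first by rewrite ln0 // mul0r.
by rewrite ler_pdivrMr ?ln_gt0 ?ltr1n // -ln_powR ler_ln ?posrE ?powR_gt0.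
Qed.

Lemma powR2_add (R : realType) (x y : R) : 2 `^ (x + y) = 2 `^ x * 2 `^ y :> R.
Proof. by rewrite powRD // pnatr_eq0 implybT. Qed.

Lemma powR2_ge1 (R : realType) (x : R) : 0 <= x -> 1 <= 2 `^ x :> R.
Proof. by move=> x0; rewrite -[leLHS](powRr0 2) ler_powR // ler1n. Qed.

(** The given bounds are arbitrary polynomials, possibly negative or decreasing. Taking absolute
    values of coefficients makes them nonnegative and monotone on nonnegative arguments, so that n
    may be replaced by n^d. *)
Definition poly_majorant (R : realDomainType) (p : {poly R}) : {poly R} :=
  \poly_(i < size p) `|p`_i|.

Lemma poly_majorant_ge0 (R : realDomainType) (p : {poly R}) x :
  0 <= x -> 0 <= (poly_majorant p).[x].
Proof.
by move=> x0; rewrite horner_poly sumr_ge0 // => i _; rewrite mulr_ge0 ?exprn_ge0.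
Qed.

Lemma le_poly_majorant (R : realDomainType) (p : {poly R}) x y :
  0 <= x -> x <= y -> p.[x] <= (poly_majorant p).[y].
Proof.
move=> x0 xy; rewrite horner_coef horner_poly; apply: ler_sum => i _.
apply: le_trans (ler_norm _) _; rewrite normrM ler_wpM2l // ger0_norm ?exprn_ge0 //.
by rewrite lerXn2r // nnegrE (le_trans x0).
Qed.

(** The multivariate analogue serves for the completeness exponent, whose norm argument is known
    only through an upper bound. *)
Definition mpoly_majorant (R : realType) n (f : {mpoly R[n]}) : {mpoly R[n]} :=
  \sum_(mo <- msupp f) `|f@_mo| *: 'X_[mo].

Lemma le_mpoly_majorant (R : realType) n (f : {mpoly R[n]}) (u v : 'I_n -> R) :
  (forall i, 0 <= u i <= v i) -> f.@[u] <= (mpoly_majorant f).@[v].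
Proof.
move=> uv; rewrite mevalE raddf_sum; apply: ler_sum => mo _ /=.
rewrite mevalZ mevalX; have P0 : 0 <= \prod_(i < n) u i ^+ mo i.
  by apply: prodr_ge0 => i _; rewrite exprn_ge0; case/andP: (uv i).
apply: le_trans (ler_norm _) _; rewrite normrM ler_wpM2l // ger0_norm //.
apply: ler_prod => i _; have /andP[u0 uvi] := uv i.
by rewrite exprn_ge0 //= lerXn2r // nnegrE (le_trans u0).
Qed.

Lemma mpoly_majorant_ge0 (R : realType) n (f : {mpoly R[n]}) (v : 'I_n -> R) :
  (forall i, 0 <= v i) -> 0 <= (mpoly_majorant f).@[v].
Proof.
move=> v0; rewrite raddf_sum sumr_ge0 // => mo _ /=.
by rewrite mevalZ mevalX mulr_ge0 // prodr_ge0 // => i _; rewrite exprn_ge0.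
Qed.

Lemma meval_horner_mpolyC (R : realType) n (p : {poly R}) (t : {mpoly R[n]}) v :
  (map_poly (@mpolyC n R) p).[t].@[v] = p.[t.@[v]].
Proof.
rewrite -horner_map -map_poly_comp; congr _.[_].
by apply: map_poly_id => c _ /=; rewrite mevalC.
Qed.

(** * Degrees and values of SoS proofs, and the replacement of their squares *)

Lemma mpdeg_sqr_half (R : realType) n d (s : {mpoly R[n]}) :
  (mpdeg (s ^+ 2) <= 2 * d)%N -> (mpdeg s <= d)%N.
Proof.
rewrite !mpdeg_leq; have [->|s0] := eqVneq s 0; first by rewrite msize0.
by rewrite expr2 msizeM //; move: (msize s) => k; lia.
Qed.

Lemma msize_sum_le (R : realType) n (I : eqType) (l : seq I) (F : I -> {mpoly R[n]}) k :
  {in l, forall i, (msize (F i) <= k)%N} -> (msize (\sum_(i <- l) F i) <= k)%N.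
Proof.
move=> lk; apply: leq_trans (msize_sum _ _ _) _.
by apply/bigmax_leqP_seq => i il _; apply: lk.
Qed.

Lemma mpdeg_sos_le (R : realType) n m (P : 'I_m -> {mpoly R[n]}) q (pf : sos_proof P q) :
  (mpdeg q <= sos_degree pf)%N.
Proof.
rewrite mpdeg_leq {1}(sos_eq pf); apply: leq_trans (msizeD_le _ _) _.
rewrite geq_max; apply/andP; split; apply: msize_sum_le => i il; rewrite -mpdeg_leq.
  by rewrite /sos_degree leq_max (leq_bigmax_seq i).
by rewrite /sos_degree leq_max (leq_bigmax_seq i) ?orbT.
Qed.

Lemma evalpt_sos (R : realType) n m (P : 'I_m -> {mpoly R[n]}) q (pf : sos_proof P q)
    (a : 'rV[R]_n) :
  (forall i, evalpt (P i) a = 0) -> evalpt q a = \sum_(s <- sos_sq pf) evalpt s a ^+ 2.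
Proof.
move=> Pa; rewrite {1}(sos_eq pf) /evalpt mevalD !raddf_sum /=.
rewrite [X in _ + X]big1 ?addr0 => [|i _]; last by rewrite mevalM [X in _ * X]Pa mulr0.
by apply: eq_bigr => s _; rewrite rmorphXn.
Qed.

Lemma mpdeg_sqr (R : realType) n d (s : {mpoly R[n]}) :
  (mpdeg s <= d)%N -> (mpdeg (s ^+ 2) <= 2 * d)%N.
Proof.
rewrite !mpdeg_leq expr2; have [->|s0] := eqVneq s 0; first by rewrite mul0r msize0.
by rewrite msizeM //; move: (msize s) => k; lia.
Qed.

(** On S the multiples of the equations vanish, so the old squares, whatever their coefficients, sum
    there to r and have average at most K. *)
Lemma sos_proof_split (R : realType) n m d (P : 'I_m -> {mpoly R[n]})
    (S : {fset 'rV[R]_n}) (r : {mpoly R[n]}) (delta K : R) (pf : sos_proof P r) :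
  is_variety P S -> 0 < delta -> spectrally_rich d delta S ->
  (sos_degree pf <= 2 * d)%N -> 0 <= K -> {in S, forall a, evalpt r a <= K} ->
  exists l : seq {mpoly R[n]},
    [/\ {in l, forall s, (mpdeg s <= d)%N},
      vanishing (2 * d) S (r - \sum_(s <- l) s ^+ 2)
      & \sum_(s <- l) coef_sqnorm s <= K * delta^-1].
Proof.
move=> varS delta0 rich degpf K0 rK.
have sdeg : {in sos_sq pf, forall s, (mpdeg s <= d)%N}.
  move=> s sl; apply: mpdeg_sqr_half; apply: leq_trans degpf.
  by rewrite /sos_degree leq_max (leq_bigmax_seq s).
have rS a : a \in S -> evalpt r a = \sum_(s <- sos_sq pf) evalpt s a ^+ 2.
  by move=> /varS; apply: evalpt_sos.
have [l [ldeg lS lle]] := spectrally_rich_representatives rich sdeg.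
exists l; split => //; last first.
  rewrite ler_pdivlMr // mulrC; apply: le_trans lle _.
  apply: (@le_trans _ _ ((#|` S|%fset%:R)^-1 * \sum_(a <- S) K)).
    rewrite ler_wpM2l ?invr_ge0 // big_seq [leRHS]big_seq.
    by apply: ler_sum => a aS; rewrite -rS // rK.
  rewrite big_const_seq count_predT iter_addr_0.
  (* For empty S the average is 0, which is at most K because K is nonnegative. *)
  have [->|S0] := eqVneq #|` S|%fset 0%N; first by rewrite mulr0n mulr0.
  by rewrite -[K *+ _]mulr_natl mulrA mulVf ?mul1r // pnatr_eq0.
split.
  rewrite mpdeg_leq; apply: leq_trans (msizeD_le _ _) _; rewrite msizeN geq_max.
  rewrite -!mpdeg_leq (leq_trans (mpdeg_sos_le pf)) //= mpdeg_leq.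
  by apply: msize_sum_le => s /ldeg /mpdeg_sqr; rewrite mpdeg_leq.
move=> a aS; rewrite /evalpt mevalB -/(evalpt r a) rS // -lS //.
apply/eqP; rewrite subr_eq0 raddf_sum /=; apply/eqP.
by apply: eq_bigr => s _; rewrite rmorphXn.
Qed.

(** * The new proof and its coefficient bounds *)

Theorem mainTheorem3 (R : realType) (C : nat) :
  exists C' : nat,
  forall (d : nat) (bits bnd : {poly R}) (f : {mpoly R[3]}),
  (0 < d)%N ->
  exists g : {mpoly R[3]},
  forall (n m : nat) (P : 'I_m -> {mpoly R[n]}) (S : {fset 'rV[R]_n})
    (r : {mpoly R[n]}) (delta : R),
  bit_complexity_le P bits.[n%:R] ->
  bit_complexity_le (fun _ : 'I_1 => r) bits.[n%:R] ->
  is_variety P S ->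
  set_norm S <= 2 `^ bnd.[(n ^ d)%N%:R] ->
  0 < delta ->
  spectrally_rich d delta S ->
  sos_eps_complete d C f P S ->
  (exists pf : sos_proof P r, (sos_degree pf <= 2 * d)%N) ->
  forall eps : R, 0 < eps ->
  exists pf : sos_proof P (r + eps%:MP),
    (sos_degree pf <= C' * d)%N /\
    sos_coef_le pf (2 `^ poly3 g (n ^ d)%N%:R (lg delta^-1) (lg eps^-1)).
Proof.
(* The new squares have degree at most 2d, the proof supplied by completeness at most C d. *)
exists (maxn 2 C) => d bits bnd f d0.
pose lift p : {mpoly R[3]} := (map_poly (@mpolyC 3 R) (poly_majorant p)).['X_ord0].
(* The variables stand for n^d, lg(1/delta) and lg(1/eps). [Q] bounds the logarithm of the
   coefficients of q = r - (sum of new squares): the first two terms bound r on S, the third is the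
   division by delta, and the 1 comes from the difference. *)
pose Q : {mpoly R[3]} := lift bits + (2 * d)%:R * lift bnd + 'X_(inord 1) + 1.
(* [F] is the completeness exponent with [Q] in place of lg of the norm of q. Both take nonnegative
   values here, so [Q + F] covers the new squares through [Q] and the supplied proof through [F]. *)
pose F := mpoly_majorant f \mPo [tuple 'X_ord0; Q; 'X_ord_max].
exists (Q + F) => n m P S r delta _ rbits varS normS delta0 rich complete [pf degpf] eps eps0.
set N : R := (n ^ d)%N%:R in normS complete *.
set D := lg delta^-1; set E := lg eps^-1.
pose v := tnth [tuple N; D; E].
have N0 : 0 <= N by rewrite ler0n.
have D0 : 0 <= D by apply: lg_ge0.
have E0 : 0 <= E by apply: lg_ge0.
have v1 : v (inord 1) = D by rewrite /v (tnth_nth 0) inordK.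
pose b := (poly_majorant bits).[N]; pose c := (poly_majorant bnd).[N].
have b0 : 0 <= b by apply: poly_majorant_ge0.
have c0 : 0 <= c by apply: poly_majorant_ge0.
pose t := b + (2 * d)%:R * c + D.
have QE : Q.@[v] = t + 1.
  rewrite !mevalD mevalM !meval_horner_mpolyC !mevalXU v1 meval1.
  by rewrite rmorph_nat.
have t0 : 0 <= t by rewrite !addr_ge0 // mulr_ge0.
have FE : F.@[v] = (mpoly_majorant f).@[tnth [tuple N; t + 1; E]].
  rewrite comp_mpoly_meval; apply: meval_eq => i.
  case: i => [[|[|[|//]]] ilt]; rewrite !(tnth_nth 0) /= ?mevalXU ?QE //.
have TE : forall x, lg x <= t + 1 -> poly3 f N (lg x) E <= F.@[v].
  move=> x xt; rewrite FE; apply: le_mpoly_majorant => i.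
  by case: i => [[|[|[|//]]] ilt]; rewrite !(tnth_nth 0) /= ?lexx ?lg_ge0 ?xt ?N0 ?E0.
have F0 : 0 <= F.@[v].
  rewrite FE; apply: mpoly_majorant_ge0 => i.
  by case: i => [[|[|[|//]]] ilt]; rewrite !(tnth_nth 0) //= addr_ge0.
(* The bit bound is a polynomial in n, the final one in n^d; d > 0 links them. *)
have nN : n%:R <= N.
  by rewrite ler_nat; case: (posnP n) => [->|n0] //; rewrite -[leqLHS]expn1 leq_pexp2l.
have l1r : coef_l1norm r <= 2 `^ b.
  apply: le_trans (coef_l1norm_bits rbits) _; rewrite ler_powR ?ler1n //.
  exact: le_poly_majorant.
have rK : {in S, forall a, evalpt r a <= 2 `^ (b + (2 * d)%:R * c)}.
  move=> a aS; apply: le_trans (ler_norm _) _.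
  have rdeg : (mpdeg r <= 2 * d)%N by apply: leq_trans (mpdeg_sos_le pf) degpf.
  apply: le_trans (normr_evalpt_le rdeg (powR2_ge1 c0) _) _.
    move=> i; apply: le_trans (normr_coord_le i aS) _; apply: le_trans normS _.
    by rewrite ler_powR ?ler1n // le_poly_majorant.
  rewrite powR2_add (mulrC _ c) powRrM powR_mulrn ?powR_ge0 //.
  by rewrite ler_wpM2r // exprn_ge0 // powR_ge0.
have [l [ldeg lvan lle]] := sos_proof_split varS delta0 rich degpf (powR_ge0 _ _) rK.
have lt : \sum_(s <- l) coef_sqnorm s <= 2 `^ t.
  by apply: le_trans lle _; rewrite /t [leRHS]powR2_add ler_wpM2l ?powR_ge0 // le_powR_lg.
(* The coefficients of r and of the sum of squares are each at most 2^t. *)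
have qle : coef_norm (r - \sum_(s <- l) s ^+ 2) <= 2 `^ (t + 1).
  apply: coef_norm_le => [|mo]; first exact: powR_ge0.
  rewrite powR2_add powRr1 // mulr_natr mulr2n mcoeffB raddf_sum /=.
  apply: le_trans (ler_normB _ _) _; rewrite lerD //.
    apply: le_trans (normr_mcoeff_le _ _) (le_trans l1r _).
    by rewrite ler_powR ?ler1n // /t -addrA lerDl addr_ge0 // mulr_ge0.
  apply: le_trans (ler_norm_sum _ _ _) (le_trans _ lt).
  by apply: ler_sum => s _; apply: mcoeff_sqr_le.
have [pf' [deg' [sq' mult']]] := complete _ lvan _ eps0.
have expo_le : 2 `^ poly3 f N (lg (coef_norm (r - \sum_(s <- l) s ^+ 2))) E
    <= 2 `^ poly3 (Q + F) N D E.
  rewrite ler_powR ?ler1n // /poly3 mevalD -/v; apply: le_trans (TE _ _) _.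
    by apply: lg_le => //; rewrite addr_ge0.
  by rewrite lerDr QE addr_ge0.
have eq' : r + eps%:MP = \sum_(s <- l ++ sos_sq pf') s ^+ 2
    + \sum_(i < m) sos_mult pf' i * P i.
  by rewrite big_cat -addrA -(sos_eq pf') addrA addrCA subrr addr0.
exists (SosProof eq'); split.
  rewrite geq_max /=; apply/andP; split; last first.
    apply: leq_trans (leq_trans (leq_maxr _ _) deg') _.
    by rewrite leq_mul2r leq_maxr orbT.
  rewrite big_cat /= geq_max; apply/andP; split.
    apply/bigmax_leqP_seq => s /ldeg sd _.
    apply: (@leq_trans (2 * d)); last by rewrite leq_mul2r leq_maxl orbT.
    exact: mpdeg_sqr.
  apply: leq_trans (leq_trans (leq_maxl _ _) deg') _.
  by rewrite leq_mul2r leq_maxr orbT.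
split => [s|i]; last exact: le_trans (mult' i) expo_le.
rewrite /= mem_cat => /orP[sl|/sq' sB]; last exact: le_trans sB expo_le.
apply: coef_norm_le => [|mo]; first exact: powR_ge0.
have smo : s@_mo ^+ 2 <= 2 `^ t.
  apply: le_trans (sqr_mcoeff_le _ _) (le_trans _ lt).
  by rewrite (big_rem s) //= lerDl sumr_ge0 // => ? _; apply: coef_sqnorm_ge0.
(* Only the square of the coefficient is known to be at most 2^t; since 2^t >= 1, the coefficient
   itself obeys the same bound. *)
apply: (@le_trans _ _ (2 `^ t)).
  have := powR2_ge1 t0; rewrite -real_normK ?num_real // in smo *.
  by have := normr_ge0 s@_mo; nra.
rewrite ler_powR ?ler1n // /poly3 mevalD -/v QE -addrA lerDl.
by rewrite addr_ge0.
Qed.
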